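(* For all integers $m\geq 23$ and $n\geq 3$, $$\frac{2mn}{13}+\frac{2620\,n}{13767}\leq mp_{f,2}(P_m\square C_n).$$
   Context: $P_m$ denotes the path on $m$ vertices, $C_n$ the cycle on $n$ vertices, and $\square$ the Cartesian product of graphs; $d$ denotes graph distance. For a finite graph $G$, the fractional $2$-limited multipacking number $mp_{f,2}(G)$ is the optimal value of the linear program: maximize $\sum_{i\in V(G)}y_i$ over real variables $(y_i)_{i\in V(G)}$ subject to $y_i\geq 0$ for every $i\in V(G)$ and $\sum_{i\in V(G):\, d(i,j)\leq \ell}y_i\leq \ell$ for every vertex $j\in V(G)$ and every $\ell\in\{1,2\}$. *)

(* Defs.v *)
From HB Require Import structures.
From mathcomp Require Import all_boot all_order all_algebra.
From mathcomp Require Import all_classical all_reals.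

Set Implicit Arguments.
Unset Strict Implicit.
Unset Printing Implicit Defensive.

Import Order.TTheory GRing.Theory Num.Theory.

Local Open Scope classical_set_scope.
Local Open Scope ring_scope.

Record sgraph := SGraph {
  vertex :> finType;
  adj : rel vertex;
  adj_sym : symmetric adj;
  adj_irrefl : irreflexive adj }.

Section Distance.
Variable G : sgraph.
Implicit Types (x y : G) (k l : nat).

Definition walk k x y : bool :=
  [exists p : k.-tuple G, path (@adj G) x p && (last x p == y)].

(* Length of a shortest walk from x to y. Distances in a connected component
   are less than #|G|, so the search may stop there; the value is #|G|, and
   meaningless, when y is not reachable from x. *)
Definition dist x y : nat := find (fun k => walk k x y) (iota 0 #|G|).

(* d(x, y) <= l, where d(x, y) is infinite if x and y are not connected. *)
Definition dist_le l x y : bool := connect (@adj G) x y && (dist x y <= l)%N.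

End Distance.

Section PathGraph.
Variable m : nat.

Definition path_adj : rel 'I_m := fun i j => (i.+1 == j :> nat) || (j.+1 == i :> nat).

Lemma path_adj_sym : symmetric path_adj.
Proof. by move=> i j; rewrite /path_adj orbC. Qed.

Lemma path_adj_irrefl : irreflexive path_adj.
Proof. by move=> i; rewrite /path_adj orbb gtn_eqF. Qed.

Definition path_graph : sgraph := SGraph path_adj_sym path_adj_irrefl.
End PathGraph.

Section CycleGraph.
Variable n : nat.

(* ordS is the successor modulo n. The condition i != j only matters for
   n = 1, where it excludes a loop; this is the usual cycle for n >= 3. *)
Definition cycle_adj : rel 'I_n :=
  fun i j => (i != j) && ((ordS i == j) || (ordS j == i)).

Lemma cycle_adj_sym : symmetric cycle_adj.
Proof. by move=> i j; rewrite /cycle_adj eq_sym orbC. Qed.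

Lemma cycle_adj_irrefl : irreflexive cycle_adj.
Proof. by move=> i; rewrite /cycle_adj eqxx. Qed.

Definition cycle_graph : sgraph := SGraph cycle_adj_sym cycle_adj_irrefl.
End CycleGraph.

Section CartesianProduct.
Variables G H : sgraph.

Definition cart_adj : rel (G * H)%type := fun u v =>
  ((u.1 == v.1) && adj u.2 v.2) || (adj u.1 v.1 && (u.2 == v.2)).

Lemma cart_adj_sym : symmetric cart_adj.
Proof.
move=> u v; rewrite /cart_adj (eq_sym u.1) (eq_sym u.2).
by rewrite (adj_sym u.1) (adj_sym u.2).
Qed.

Lemma cart_adj_irrefl : irreflexive cart_adj.
Proof. by move=> u; rewrite /cart_adj !adj_irrefl andbF. Qed.

Definition cart_prod : sgraph := SGraph cart_adj_sym cart_adj_irrefl.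
End CartesianProduct.

Section Multipacking.
Variables (R : realType) (G : sgraph).

Definition mpf2_feasible (y : G -> R) : Prop :=
  (forall i, 0 <= y i) /\
  (forall (j : G) (l : nat), l \in [:: 1; 2]%N ->
     \sum_(i : G | dist_le l i j) y i <= l%:R).

Definition mpf2_values : set R :=
  [set \sum_(i : G) y i | y in [set y : G -> R | mpf2_feasible y]].

(* The optimal value, as a supremum; mpf2_has_sup rules out the default value
   of sup. *)
Definition mpf2 : R := sup mpf2_values.

Lemma dist_lexx l (x : G) : dist_le l x x.
Proof.
rewrite /dist_le connect0 /dist /=.
have : (0 < #|G|)%N by apply/card_gt0P; exists x.
case: #|G| => //= k _.
suff -> : walk 0 x x by [].
by apply/existsP; exists [tuple]; rewrite /= eqxx.
Qed.

Lemma mpf2_has_sup : has_sup mpf2_values.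
Proof.
split.
  exists (\sum_(i : G) 0), (fun=> 0) => //; split=> // j l _.
  by rewrite big1 // ler0n.
exists #|G|%:R => _ [y [y0 yl] <-].
rewrite -sum1_card natr_sum; apply: ler_sum => i _.
have := yl i 1%N isT; apply: le_trans.
by rewrite (bigD1 i) ?dist_lexx //= lerDl sumr_ge0.
Qed.

End Multipacking.

(* Main.v *)
Require Import Defs.
From mathcomp Require Import all_boot all_order all_algebra.
From mathcomp Require Import all_classical all_reals.
From mathcomp Require Import zify ring lra.
Import Order.TTheory GRing.Theory Num.Theory.
Local Open Scope ring_scope.

(** A feasible solution that is constant on every copy of the cycle is given by
    one weight per row of the grid.  A ball of radius l meets a row at distance
    d <= l in at most 2 (l - d) + 1 vertices ([ball_sum_le]), so feasibility
    reduces to one inequality per row and per radius: with row weights a,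
      a(r-1) + 3 a(r) + a(r+1) <= 1   and
      a(r-2) + 3 a(r-1) + 5 a(r) + 3 a(r+1) + a(r+2) <= 2,
    where rows outside the path count for 0.  In an infinite strip the constant
    weight 2/13 makes the second inequality tight.  Near an end of the path the
    missing rows leave slack, and moving weight among the eight rows next to
    the end gains 1310/13767 per column ([end_excess], [sum_end_excess]); these
    weights solve the linear program in which all further rows carry 2/13.
    Since m >= 23, no radius 2 window meets the first eight and the last eight
    rows at once, so both ends can be corrected independently, for a gain of
    2620/13767 in each of the n columns. *)

(** * Balls in the grid *)

(** The search that defines the distance succeeds because a shortest walk
    repeats no vertex, so its length is below #|G|. *)
Lemma dist_leW (G : sgraph) l (x y : G) :
  dist_le l x y -> exists2 k, (k <= l)%N & walk k x y.
Proof.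
case/andP=> /connectP[p xp ->{y}] dl; exists (dist x (last x p)) => //.
case/shortenP: xp {dl} => q xq uq _.
have szq : (size q < #|G|)%N by have := max_card (mem (x :: q)); rewrite (card_uniqP uq).
have : has (fun k => walk k x (last x q)) (iota 0 #|G|).
  apply/hasP; exists (size q); first by rewrite mem_iota.
  by apply/existsP; exists (in_tuple q); rewrite xq eqxx.
move=> hw; have := nth_find 0%N hw; rewrite nth_iota //.
by rewrite -[X in (_ < X)%N](size_iota 0) -has_find.
Qed.

(** The vertical moves account for the distance between the rows; the other t
    moves shift the column by a signed amount e - t, between - t and t. *)
Lemma walk_grid m n k (u v : cart_prod (path_graph m) (cycle_graph n)) :
  walk k u v -> exists t e : nat,
    [/\ (u.1 - v.1 + (v.1 - u.1) + t <= k)%N, (e <= t.*2)%N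
      & u.2 + t = v.2 + e %[mod n]].
Proof.
case/existsP=> p /andP[+ /eqP].
elim: k u p => [|k IH] u p.
  by rewrite tuple0 /= => _ ->; exists 0%N, 0%N; split; rewrite ?subnn.
case/tupleP: p => w p /= /andP[uw wp] ep.
have [t [e [h1 h2 h3]]] := IH w p wp ep.
case/orP: uw => /andP[].
- move=> /eqP -> /andP[_ /orP[/eqP uw|/eqP wu]].
  + exists t.+1, e; split; [by rewrite addnS | lia |].
    by rewrite -h3 -uw /= modnDml addSnnS.
  + exists t.+1, e.+2; split; [by rewrite addnS | lia |].
    rewrite -wu /= modnDml -[in LHS]addn1 -[in LHS](addn1 t).
    have -> : (w.2 + 1 + (t + 1) = w.2 + t + 2)%N by lia.
    have -> : (v.2 + e.+2 = v.2 + e + 2)%N by lia.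
    by rewrite -modnDml h3 modnDml.
- move=> uw /eqP ->; exists t, e; split => //.
  have step (i j s : 'I_m) : path_adj i j ->
      (i - s + (s - i) <= (j - s + (s - j)).+1)%N.
    by case/orP => /eqP; lia.
  by apply: leq_trans (leq_add (step _ _ v.1 uw) (leqnn t)) _; rewrite addSn.
Qed.

(** The largest number of vertices in which a ball of radius l, centred in row s,
    can meet row r; a short cycle may have fewer.  The truncated operations give 0 for rows farther than l. *)
Definition ball_width (l r s : nat) : nat := (l.+1 - (r - s + (s - r))).*2.-1.

Lemma card_ball_row m n l (r : 'I_m)
    (v : cart_prod (path_graph m) (cycle_graph n)) :
  (#|[set c : 'I_n | dist_le l ((r, c) : cart_prod (path_graph m) (cycle_graph n)) v]|
    <= ball_width l r v.1)%N.
Proof.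
have n0 : (0 < n)%N by case: (v) => _ [c]; case: (n).
set d := (r - v.1 + (v.1 - r))%N; set t := (l - d)%N.
(* Subtraction of t modulo n is written as addition of (n - 1) t. *)
pose shift (e : 'I_(ball_width l r v.1)) : 'I_n :=
  Ordinal (ltn_pmod (v.2 + e + n.-1 * t) n0).
rewrite -[leqRHS]card_ord -cardsT; apply: leq_trans (leq_imset_card shift _).
apply/subset_leq_card/fintype.subsetP=> c; rewrite inE => /dist_leW[k kl].
(* The walk may spend fewer than t moves on columns; padding by t - t0 keeps
   the signed shift e - t0. *)
case/walk_grid=> t0 [e [/= h1 h2 h3]].
have {}h1 : (d + t0 <= k)%N := h1.
have eb : (e + (t - t0) < ball_width l r v.1)%N.
  by rewrite /ball_width -/d; lia.
apply/imsetP; exists (Ordinal eb) => //; apply: val_inj => /=.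
have -> : (v.2 + (e + (t - t0)) + n.-1 * t = v.2 + e + (t - t0 + n.-1 * t))%N by lia.
rewrite -modnDml -h3 modnDml.
have -> : (c + t0 + (t - t0 + n.-1 * t) = t * n + c)%N by nia.
by rewrite modnMDl modn_small.
Qed.

Lemma sum_grid (R : realType) m n
    (F : cart_prod (path_graph m) (cycle_graph n) -> R) :
  \sum_u F u = \sum_(r < m) \sum_(c < n) F (r, c).
Proof. by rewrite pair_bigA; apply: eq_bigr => -[]. Qed.

Lemma ball_sum_le (R : realType) m n l (a : 'I_m -> R)
    (v : cart_prod (path_graph m) (cycle_graph n)) :
  (forall r, 0 <= a r) ->
  \sum_(u : cart_prod (path_graph m) (cycle_graph n) | dist_le l u v) a u.1
    <= \sum_r a r * (ball_width l r v.1)%:R.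
Proof.
move=> a0; rewrite big_mkcond sum_grid /=.
apply: ler_sum => r _; rewrite -big_mkcond sumr_const -[leLHS]mulr_natr.
apply: ler_wpM2l => //; rewrite ler_nat.
by apply: leq_trans (card_ball_row m n l r v); rewrite cardsE.
Qed.

(** * Row weights *)

(** Excess over 2/13 of the weight of the row at distance i from the only end of
    a one-way infinite path.  The values are an optimal vertex of the linear
    program in the first eight rows; 156 * 353 is 4 * 13767. *)
Definition end_excess (R : realType) (i : nat) : R :=
  nth 0 [:: 8167; -3321; -240; 1296; -892; 237; 101; -108] i / (156 * 353).

Definition end_weight (R : realType) (i : nat) : R := 2 / 13 + end_excess R i.

Lemma end_excess_far (R : realType) i : (8 <= i)%N -> end_excess R i = 0.
Proof. by move=> i8; rewrite /end_excess nth_default ?mul0r. Qed.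

Lemma end_weight_ge0 (R : realType) i : 0 <= end_weight R i.
Proof.
rewrite /end_weight; have [/end_excess_far ->|] := leqP 8 i; first by lra.
by rewrite /end_excess; do 8 (case: i => [|i] /=; first by move=> _; lra).
Qed.

Lemma sum_end_excess (R : realType) m : (8 <= m)%N ->
  \sum_(i < m) end_excess R i = 1310 / 13767.
Proof.
move=> /subnKC <-; rewrite big_split_ord /= [X in _ + X]big1 => [|i _].
  by rewrite !big_ord_recr big_ord0 /end_excess /=; lra.
by rewrite end_excess_far // leq_addr.
Qed.

Ltac compute_ball_width :=
  repeat match goal with |- context [ball_width ?l ?r ?s] =>
    let w := eval vm_compute in (ball_width l r s) in
    change (ball_width l r s) with w
  end.

(** The rows below s + 3 are all that a ball of radius 2 centred in row s can
    meet.  For s >= 10 those that it does meet have weight 2/13, which leaves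
    5 * 2/13 <= 1 and 13 * 2/13 <= 2; the smaller s are checked one by one. *)
Lemma end_weight_window (R : realType) s l : l \in [:: 1; 2]%N ->
  \sum_(r < s + 3) end_weight R r * (ball_width l r s)%:R <= l%:R.
Proof.
move=> hl; have {hl} : l = 1%N \/ l = 2%N by move: hl; rewrite !inE => /orP[]/eqP; auto.
case: s => [|[|s]] hl.
- rewrite !big_ord_recr big_ord0 /end_weight /end_excess /=.
  by case: hl => ->; compute_ball_width; lra.
- rewrite !big_ord_recr big_ord0 /end_weight /end_excess /=.
  by case: hl => ->; compute_ball_width; lra.
have l2 : (l <= 2)%N by case: hl => ->.
rewrite (_ : s.+2 + 3 = s + 5)%N; last by lia.
rewrite big_split_ord /= big1 => [|i _]; last first.
  by rewrite (_ : ball_width _ _ _ = 0%N) ?mulr0 // /ball_width; have := ltn_ord i; lia.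
rewrite !big_ord_recr big_ord0 /=.
have W i : ball_width l (s + i) s.+2 = ball_width l i 2 by rewrite /ball_width; lia.
rewrite !W !add0r /end_weight {W}.
have [s8|] := leqP 8 s.
  rewrite !end_excess_far; try lia.
  by case: hl => ->; compute_ball_width; lra.
rewrite /end_excess.
by case: hl => ->; compute_ball_width; do 8 (case: s => [|s] /=; first by move=> _; lra).
Qed.

Definition row_weight (R : realType) (m : nat) (r : 'I_m) : R :=
  2 / 13 + end_excess R r + end_excess R (rev_ord r).

Lemma row_weight_rev (R : realType) m (r : 'I_m) :
  row_weight R m (rev_ord r) = row_weight R m r.
Proof. by rewrite /row_weight rev_ordK addrAC. Qed.

Lemma row_weight_near (R : realType) m (r : 'I_m) : (8 <= rev_ord r)%N ->
  row_weight R m r = end_weight R r.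
Proof. by move=> r8; rewrite /row_weight (end_excess_far R _ r8) addr0. Qed.

Lemma row_weight_ge0 (R : realType) m (r : 'I_m) : (16 <= m)%N ->
  0 <= row_weight R m r.
Proof.
move=> hm; have [r8|r8] := leqP 8 r; last first.
  by rewrite row_weight_near ?end_weight_ge0 //=; lia.
by rewrite -row_weight_rev row_weight_near ?rev_ordK ?end_weight_ge0.
Qed.

Lemma sum_row_weight (R : realType) m : (8 <= m)%N ->
  \sum_r row_weight R m r = 2 / 13 * m%:R + 2620 / 13767.
Proof.
move=> hm; rewrite !big_split sumr_const card_ord -mulr_natr.
rewrite [X in _ + X = _](reindex_inj rev_ord_inj).
under [X in _ + X = _]eq_bigr => r _ do rewrite rev_ordK.
by rewrite /= sum_end_excess //; lra.
Qed.

(** Reflecting the path, s may be assumed to lie in its first half; then the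
    rows near s do not see the correction at the far end. *)
Lemma row_weight_window (R : realType) m l (s : 'I_m) :
  (23 <= m)%N -> l \in [:: 1; 2]%N ->
  \sum_r row_weight R m r * (ball_width l r s)%:R <= l%:R.
Proof.
move=> hm hl.
wlog hs : s / (s <= rev_ord s)%N.
  move=> H; have [|/ltnW sr] := leqP s (rev_ord s); first exact: H.
  have := H (rev_ord s); rewrite rev_ordK => /(_ sr); apply: le_trans.
  rewrite (reindex_inj rev_ord_inj) /=; apply: ler_sum => r _.
  rewrite row_weight_rev (_ : ball_width _ _ _ = ball_width l r (rev_ord s)) //.
  by rewrite /ball_width /=; have := ltn_ord r; have := ltn_ord s; lia.
have l2 : (l <= 2)%N by move: hl; rewrite !inE => /orP[]/eqP ->.
have sm : (s + 3 <= m)%N by move: hs => /=; lia.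
apply: le_trans (end_weight_window R s l hl).
rewrite (big_ord_widen _ (fun r => end_weight R r * (ball_width l r s)%:R) sm).
rewrite [leRHS]big_mkcond /=; apply: ler_sum => r _; case: ifPn => rs.
  by rewrite row_weight_near //; move: hs => /=; lia.
by rewrite (_ : ball_width _ _ _ = 0%N) ?mulr0 // /ball_width; lia.
Qed.

Theorem theorem10 (R : realType) (m n : nat) (hm : (23 <= m)%N) (hn : (3 <= n)%N) :
  (2 * m%:R * n%:R) / 13 + (2620 * n%:R) / 13767
    <= mpf2 R (cart_prod (path_graph m) (cycle_graph n)).
Proof.
apply: ub_le_sup; first by case: (mpf2_has_sup R (cart_prod (path_graph m) (cycle_graph n))).
have w0 r : 0 <= row_weight R m r by apply: row_weight_ge0; lia.
exists (fun u => row_weight R m u.1).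
  split=> [u|v l hl]; first exact: w0.
  exact: le_trans (ball_sum_le _ _ _ _ _ v w0) (row_weight_window _ _ _ v.1 hm hl).
rewrite sum_grid /=.
under eq_bigr => r _ do rewrite sumr_const card_ord -mulr_natr.
by rewrite -mulr_suml sum_row_weight; [field | lia].
Qed.
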